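(* Consider the DEI-NCG with cost parameter $\alpha$ and exactly $k=2$ agent types, blue and red, with nonempty agent sets $V_B$ and $V_R$ of sizes $n_B\le n_R$. Assume that $\frac{n_R}{n_R+1}<\alpha<1$ and let $G$ be a network on $V=V_B\cup V_R$. Then $G$ is pairwise stable if and only if $G$ is fully intra-connected and its bichromatic edges form a matching covering $V_B$.
   Context: A network is a finite simple undirected graph $G=(V,E)$ on the set $V=V_B\cup V_R$ (disjoint union) of agents. An edge is bichromatic if its endpoints have different types. $G$ is fully intra-connected if any two distinct agents of the same type are adjacent. For $u\in V$: $\deg_G(u)$ is its degree, $e_G(u)$ is the number of neighbors of $u$ whose type differs from that of $u$, and $d_G(u)=\sum_{v\in V}d_G(u,v)$ is the sum of graph distances from $u$ to all agents ($=\infty$ if $G$ is disconnected). In the DEI-NCG (network creation game with decreasing effort of integration) with parameter $\alpha>0$, the cost of agent $u$ in $G$ is $$c_G(u)=\alpha\Big(\deg_G(u)+\sum_{i=1}^{e_G(u)}\frac1i\Big)+d_G(u).$$ A network $G=(V,E)$ is pairwise stable if it is connected and (i) for every agent $u$ and every neighbor $v$ of $u$, $c_G(u)\le c_{G-uv}(u)$; and (ii) for all distinct non-adjacent agents $u,v$, $c_G(u)\le c_{G+uv}(u)$ or $c_G(v)\le c_{G+uv}(v)$. *)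

(* Defs.v *)
From mathcomp Require Import all_boot all_order all_algebra.
From mathcomp Require Import classical_sets reals constructive_ereal ereal.

Set Implicit Arguments.
Unset Strict Implicit.
Unset Printing Implicit Defensive.

Import Order.TTheory GRing.Theory Num.Theory.

Local Open Scope ring_scope.

Section Graphs.
Variable T : finType.

Definition simple_graph (e : rel T) : Prop := symmetric e /\ irreflexive e.

Definition graph_connected (e : rel T) : Prop := forall u v, connect e u v.

Definition add_edge (e : rel T) (u v : T) : rel T :=
  [rel x y | e x y || ([set x; y] == [set u; v])].

Definition del_edge (e : rel T) (u v : T) : rel T :=
  [rel x y | e x y && ([set x; y] != [set u; v])].

Definition deg (e : rel T) (u : T) : nat := #|[set v | e u v]|.

(* The infimum of the empty set is +oo, so agents in different components are
   at distance +oo. *)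
Definition dist (R : realType) (e : rel T) (u v : T) : \bar R :=
  ereal_inf
    [set ((size p)%:R)%:E | p in [set p | path e u p /\ last u p = v]]%classic.

Definition total_dist (R : realType) (e : rel T) (u : T) : \bar R :=
  (\sum_(v : T) dist R e u v)%E.

End Graphs.

Section Game.
(* ty is the type of each agent; with two types, C is bool. *)
Variables (T : finType) (C : eqType) (ty : T -> C).

Definition agents_of_type (c : C) : {set T} := [set u | ty u == c].

Definition bichromatic_deg (e : rel T) (u : T) : nat :=
  #|[set v | e u v & ty v != ty u]|.

Definition bichromatic_edges (e : rel T) : {set {set T}} :=
  [set [set u; v] | u in T, v in T & e u v && (ty u != ty v)].

Definition fully_intra_connected (e : rel T) : Prop :=
  forall u v, u != v -> ty u = ty v -> e u v.

Definition cost (R : realType) (alpha : R) (e : rel T) (u : T) : \bar R :=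
  ((alpha * ((deg e u)%:R
             + \sum_(1 <= i < (bichromatic_deg e u).+1) i%:R^-1))%:E
   + total_dist R e u)%E.

Definition pairwise_stable (R : realType) (alpha : R) (e : rel T) : Prop :=
  [/\ graph_connected e,
      forall u v, e u v ->
        (cost alpha e u <= cost alpha (del_edge e u v) u)%E
    & forall u v, u != v -> ~~ e u v ->
        (cost alpha e u <= cost alpha (add_edge e u v) u)%E \/
        (cost alpha e v <= cost alpha (add_edge e u v) v)%E].

End Game.

Definition is_matching (T : finType) (M : {set {set T}}) : Prop :=
  finset.trivIset M.

Definition matching_covers (T : finType) (M : {set {set T}}) (A : {set T}) :
  Prop := A \subset finset.cover M.

Notation blue := true (only parsing).
Notation red := false (only parsing).

(* Main.v *)
(* Adding a missing edge inside a class costs alpha < 1 and saves at least 1,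
   so stability forces both classes to be cliques, and distances are then at
   most 2 around any agent with a bichromatic neighbor. If an agent has k > 1
   bichromatic neighbors, deleting one of these edges lengthens only one
   distance, from 1 to 2, and saves alpha (1 + 1/k) >= alpha (1 + 1/n_R) > 1.
   Two unmatched agents of opposite types are at distance at least 3, so the
   edge between them costs each 2 alpha < 2 and saves at least 2. Since
   n_B <= n_R, an unmatched blue agent always has an unmatched red
   counterpart. Conversely, around a covering matching the same comparisons
   show that no deletion pays off, and a second bichromatic edge would cost a
   blue agent 3 alpha / 2 > 1 while saving only 1; it can exist only if
   n_R >= 2, which gives alpha > 2/3. *)

Require Import Defs.
From mathcomp Require Import constructive_ereal ereal.
From mathcomp Require Import all_boot all_order all_algebra.
From mathcomp Require Import reals lra.

Set Implicit Arguments.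
Unset Strict Implicit.
Unset Printing Implicit Defensive.

Import Order.TTheory GRing.Theory Num.Theory.

Local Open Scope ring_scope.

(** * Adjacency and degrees after adding or deleting one edge *)

Section EdgeSurgery.
Variable T : finType.
Implicit Types (e : rel T) (u v w x y : T).

(** Edge surgery compares unordered pairs; at the endpoint [u] this turns the comparison into a test
    on the other endpoint. *)
Lemma eq_pair_l u v y : ([set u; y] == [set u; v]) = (y == v).
Proof.
apply/eqP/eqP => [E|->//].
have: y \in [set u; v] by rewrite -E !inE eqxx orbT.
have: v \in [set u; y] by rewrite E !inE eqxx orbT.
by rewrite !inE => /orP[/eqP-> | /eqP//] /orP[/eqP->|/eqP->].
Qed.

Lemma add_edgeC e u v : add_edge e u v = add_edge e v u.
Proof. by rewrite /add_edge [[set u; v]]setUC. Qed.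

Lemma add_edge_end e u v x : add_edge e u v u x = e u x || (x == v).
Proof. by rewrite /add_edge /del_edge /= eq_pair_l. Qed.

Lemma del_edge_end e u v x : del_edge e u v u x = e u x && (x != v).
Proof. by rewrite /add_edge /del_edge /= eq_pair_l. Qed.

Lemma sub_add_edge e u v : subrel e (add_edge e u v).
Proof. by move=> x y; rewrite /add_edge /= => ->. Qed.

Lemma sub_del_edge e u v : subrel (del_edge e u v) e.
Proof. by move=> x y /andP[]. Qed.

Lemma del_edge_off e u v x y :
  x != u -> y != u -> e x y -> del_edge e u v x y.
Proof.
move=> xu yu exy; rewrite /del_edge /= exy /=; apply/eqP => E.
have: u \in [set x; y] by rewrite E !inE eqxx.
by rewrite !inE ![u == _]eq_sym (negbTE xu) (negbTE yu).
Qed.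

Lemma deg_add e u v : ~~ e u v -> deg (add_edge e u v) u = (deg e u).+1.
Proof.
move=> euv; rewrite /deg.
have -> : [set x | add_edge e u v u x] = v |: [set x | e u x].
  by apply/setP => x; rewrite !inE add_edge_end orbC.
by rewrite cardsU1 inE euv.
Qed.

Lemma deg_del e u v : e u v -> deg e u = (deg (del_edge e u v) u).+1.
Proof.
move=> euv; rewrite /deg (cardsD1 v) inE euv add1n; congr _.+1.
by apply: eq_card => x; rewrite !inE del_edge_end andbC.
Qed.

End EdgeSurgery.

(** * Bounds on single and total distances *)

Section Distance.
Variables (R : realType) (T : finType).
Implicit Types (e : rel T) (u v w x y : T).
Local Notation dist := (dist R).

Lemma dist_le e u v p :
  path e u p -> last u p = v -> (dist e u v <= (size p)%:R%:E)%E.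
Proof.
move=> pp lp; apply: ge_ereal_inf.
by exists (size p)%:R%:E => //; exists p.
Qed.

Lemma le_dist e u v n :
  (forall p, path e u p -> last u p = v -> (n <= size p)%N) ->
  (n%:R%:E <= dist e u v)%E.
Proof.
move=> H; apply/ereal_infP => _ [p [pp lp] <-].
by rewrite lee_fin ler_nat H.
Qed.

Lemma dist_ge0 e u v : (0 <= dist e u v)%E.
Proof. exact: (@le_dist e u v 0). Qed.

Lemma dist_ge1 e u v : u != v -> (1%:R%:E <= dist e u v)%E.
Proof.
move=> uv; apply: (@le_dist e u v 1); case=> //= _ /eqP.
by rewrite (negbTE uv).
Qed.

Lemma dist_ge2 e u v : u != v -> ~~ e u v -> (2%:R%:E <= dist e u v)%E.
Proof.
move=> uv euv; apply: le_dist; case=> [_ /eqP|x [|? ?] //=].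
  by rewrite (negbTE uv).
by rewrite andbT => + xv; rewrite xv (negbTE euv).
Qed.

Lemma dist_ge3 e u v : u != v -> ~~ e u v ->
  (forall x, e u x -> e x v -> False) -> (3%:R%:E <= dist e u v)%E.
Proof.
move=> uv euv H; apply: le_dist.
case=> [_ /eqP|x [|y [|? ?] //=]] /=; first by rewrite (negbTE uv).
  by rewrite andbT => + xv; rewrite xv (negbTE euv).
by move=> /and3P[ux + _] yv; rewrite yv => /(H _ ux).
Qed.

Lemma dist_self_le0 e u : (dist e u u <= 0)%E.
Proof. exact: (@dist_le e u u [::]). Qed.

Lemma dist_le1 e u v : e u v -> (dist e u v <= 1%:R%:E)%E.
Proof. by move=> euv; apply: (@dist_le e u v [:: v]) => //=; rewrite euv. Qed.

Lemma dist_le2 e u w v : e u w -> e w v -> (dist e u v <= 2%:R%:E)%E.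
Proof.
by move=> euw ewv; apply: (@dist_le e u v [:: w; v]) => //=; rewrite euw ewv.
Qed.

Lemma dist_sub e e' u v : subrel e e' -> (dist e' u v <= dist e u v)%E.
Proof.
move=> ee'; apply/ereal_infP => _ [p [pp lp] <-].
exact: dist_le (sub_path ee' pp) lp.
Qed.

(** Non-neighbours of [u] in [e] stay non-neighbours in [e'], hence are at distance at least 2
    there, while [e] reaches them in at most 2 steps. This freezes all distances but one when an
    edge is deleted, or when one is added. *)
Lemma dist_le_of_diam2 e e' u x :
  (e' u x -> e u x) ->
  (x != u -> ~~ e u x -> exists2 w, e u w & e w x) ->
  (dist e u x <= dist e' u x)%E.
Proof.
move=> sub near.
have [->|xu] := eqVneq x u.
  exact: le_trans (dist_self_le0 _ _) (dist_ge0 _ _ _).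
have [eux|neux] := boolP (e u x).
  by apply: le_trans (dist_le1 eux) (dist_ge1 _ _); rewrite eq_sym.
have [w euw ewx] := near xu neux.
apply: le_trans (dist_le2 euw ewx) (dist_ge2 _ _); first by rewrite eq_sym.
exact: contra sub neux.
Qed.

Lemma total_dist_fin e u : graph_connected e -> total_dist R e u \is a fin_num.
Proof.
move=> conn; apply/sum_fin_numP => v _ _.
have /connectP[p pp lp] := conn u v.
rewrite ge0_fin_numE ?dist_ge0 //.
exact: le_lt_trans (dist_le pp (esym lp)) (ltry _).
Qed.

Lemma total_dist_shift (m n : nat) e e' u v :
  (forall x, x != v -> (dist e u x <= dist e' u x)%E) ->
  (dist e u v <= m%:R%:E)%E -> (n%:R%:E <= dist e' u v)%E ->
  (total_dist R e u + (n%:R - m%:R)%:E <= total_dist R e' u)%E.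
Proof.
move=> H Hm Hn; rewrite /total_dist (bigD1 v isT).
rewrite (bigD1 (P := predT) (F := dist e' u) v isT) addeAC.
apply: leeD; last exact: lee_sum.
by apply: le_trans (leeD2r _ Hm) _; rewrite -EFinD addrC subrK.
Qed.

End Distance.

(** * Cost comparison of two networks, and link costs under edge surgery *)

Section Cost.
Variables (R : realType) (T : finType) (C : eqType) (ty : T -> C) (alpha : R).
Implicit Types (e : rel T) (u v w x y : T).

(** The factor of [alpha] in [cost], kept apart from the possibly infinite distance term so that
    comparisons end in real arithmetic. *)
Definition link_cost e u : R :=
  (deg e u)%:R + \sum_(1 <= i < (bichromatic_deg ty e u).+1) i%:R^-1.

Lemma cost_le (m n : nat) e e' u v :
  (forall x, x != v -> (dist R e u x <= dist R e' u x)%E) ->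
  (dist R e u v <= m%:R%:E)%E -> (n%:R%:E <= dist R e' u v)%E ->
  alpha * (link_cost e u - link_cost e' u) <= n%:R - m%:R ->
  (cost ty alpha e u <= cost ty alpha e' u)%E.
Proof.
move=> H Hm Hn; have := total_dist_shift H Hm Hn; move: (_ - m%:R) => k.
rewrite /cost -![_ + \sum_(_ <= _ < _) _]/(link_cost _ _).
case: (total_dist R e u) => [d||]; case: (total_dist R e' u) => [d'||] //=.
- by rewrite -!EFinD !lee_fin; lra.
- by move=> _; rewrite addey // leey.
- by move=> _; rewrite addeNy leNye.
Qed.

(** A strict gain is visible only between finite costs: connectivity of [e] makes its total distance
    finite, and the shift inequality then excludes [+oo] for [e']. *)
Lemma cost_lt (m n : nat) e e' u v : graph_connected e ->
  (forall x, x != v -> (dist R e' u x <= dist R e u x)%E) ->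
  (dist R e' u v <= m%:R%:E)%E -> (n%:R%:E <= dist R e u v)%E ->
  alpha * (link_cost e' u - link_cost e u) < n%:R - m%:R ->
  ~ (cost ty alpha e u <= cost ty alpha e' u)%E.
Proof.
move=> conn H Hm Hn; have := total_dist_shift H Hm Hn; move: (_ - m%:R) => k.
rewrite /cost -![_ + \sum_(_ <= _ < _) _]/(link_cost _ _).
move: (total_dist_fin R u conn).
case: (total_dist R e u) => [d||] // _; case: (total_dist R e' u) => [d'||] //=.
by rewrite -!EFinD !lee_fin; lra.
Qed.

Lemma bichromatic_deg_add e u v : ~~ e u v ->
  bichromatic_deg ty (add_edge e u v) u
    = ((ty v != ty u) + bichromatic_deg ty e u)%N.
Proof.
move=> euv; rewrite /bichromatic_deg.
have [tyvu|tyvu] := boolP (ty v != ty u); last first.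
  apply: eq_card => x; rewrite !inE ?add_edge_end ?del_edge_end.
  by case: eqP => [->|]; rewrite ?orbF // (negbTE tyvu) !andbF.
have -> : [set x | add_edge e u v u x & ty x != ty u]
    = v |: [set x | e u x & ty x != ty u].
  apply/setP => x; rewrite !inE ?add_edge_end ?del_edge_end.
  by case: eqP => [->|]; rewrite ?orbF // tyvu orbT.
by rewrite cardsU1 inE (negbTE euv).
Qed.

Lemma bichromatic_deg_del e u v : e u v ->
  bichromatic_deg ty e u
    = ((ty v != ty u) + bichromatic_deg ty (del_edge e u v) u)%N.
Proof.
move=> euv; rewrite /bichromatic_deg (cardsD1 v) inE euv; congr (_ + _)%N.
by apply: eq_card => x; rewrite !inE del_edge_end andbC andbAC.
Qed.

Lemma harmonicS n :
  \sum_(1 <= i < n.+2) i%:R^-1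
    = \sum_(1 <= i < n.+1) i%:R^-1 + n.+1%:R^-1 :> R.
Proof. by rewrite big_nat_recr. Qed.

Lemma link_cost_add_mono e u v : ~~ e u v -> ty v = ty u ->
  link_cost (add_edge e u v) u = link_cost e u + 1.
Proof.
move=> euv tyE.
by rewrite /link_cost deg_add // bichromatic_deg_add // tyE eqxx -natr1 addrAC.
Qed.

Lemma link_cost_add_bi e u v : ~~ e u v -> ty v != ty u ->
  link_cost (add_edge e u v) u
    = link_cost e u + 1 + (bichromatic_deg ty e u).+1%:R^-1.
Proof.
move=> euv tyE.
rewrite /link_cost deg_add // bichromatic_deg_add // tyE add1n harmonicS -natr1.
by rewrite addrA (addrAC _ 1).
Qed.

Lemma link_cost_del_mono e u v : e u v -> ty v = ty u ->
  link_cost e u = link_cost (del_edge e u v) u + 1.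
Proof.
move=> euv tyE.
rewrite /link_cost (deg_del euv) (bichromatic_deg_del euv) tyE eqxx.
by rewrite -natr1 addrAC.
Qed.

Lemma link_cost_del_bi e u v : e u v -> ty v != ty u ->
  link_cost e u
    = link_cost (del_edge e u v) u + 1 + (bichromatic_deg ty e u)%:R^-1.
Proof.
move=> euv tyE.
rewrite /link_cost (deg_del euv) (bichromatic_deg_del euv) tyE add1n harmonicS.
by rewrite -natr1 addrA (addrAC _ 1).
Qed.

(** * Matchings and coverings expressed through neighbours *)

Lemma bichromatic_edgeP e S x : symmetric e ->
  S \in bichromatic_edges ty e -> x \in S ->
  exists y, [/\ S = [set x; y], e x y & ty y != ty x].
Proof.
move=> sym /imset2P[a b _ /[!inE] /andP[_ /andP[eab tab]] ->].
rewrite !inE => /orP[]/eqP->.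
  by exists b; rewrite eq_sym.
by exists a; rewrite setUC sym.
Qed.

Lemma mem_bichromatic_edges e u v :
  e u v -> ty v != ty u -> [set u; v] \in bichromatic_edges ty e.
Proof.
by move=> euv tuv; apply/imset2P; exists u v => //; rewrite !inE euv eq_sym.
Qed.

(** Two bichromatic edges at [u] share [u], so disjointness of distinct edges makes them equal;
    conversely a common element of two edges can be taken as the first endpoint of both. *)
Lemma matchingP e : symmetric e ->
  is_matching (bichromatic_edges ty e) <->
  (forall u v w, e u v -> ty v != ty u -> e u w -> ty w != ty u -> v = w).
Proof.
move=> sym; split=> [/finset.trivIsetP triv u v w euv tv euw tw|uniq].
  have /= := triv _ _ (mem_bichromatic_edges euv tv)
                     (mem_bichromatic_edges euw tw).
  rewrite eq_pair_l; case: eqP => // _ /(_ isT) /pred0P /(_ u).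
  by rewrite /= !inE eqxx.
apply/finset.trivIsetP => A B AM BM; apply: contraR.
move=> /pred0Pn[x /= /andP[xA xB]].
have [y [-> exy ty_y]] := bichromatic_edgeP sym AM xA.
have [z [-> exz ty_z]] := bichromatic_edgeP sym BM xB.
by rewrite (uniq x y z).
Qed.

Lemma matching_coversP e (A : {set T}) : symmetric e ->
  matching_covers (bichromatic_edges ty e) A <->
  (forall u, u \in A -> exists2 v, e u v & ty v != ty u).
Proof.
move=> sym; split=> [/subsetP cov u /cov /bigcupP[S SM uS]|cov].
  by have [v [_ euv tv]] := bichromatic_edgeP sym SM uS; exists v.
apply/subsetP => u /cov[v euv tv]; apply/bigcupP.
by exists [set u; v]; rewrite ?mem_bichromatic_edges // !inE eqxx.
Qed.


Lemma bichromatic_deg0 e u :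
  (forall x, e u x -> ty x = ty u) -> bichromatic_deg ty e u = 0%N.
Proof.
move=> nbr; apply: eq_card0 => x; rewrite !inE.
by apply/andP => -[/nbr ->]; rewrite eqxx.
Qed.

Lemma bichromatic_deg1 e u v : e u v -> ty v != ty u ->
  (forall x, e u x -> ty x != ty u -> x = v) -> bichromatic_deg ty e u = 1%N.
Proof.
move=> euv tv uniq; rewrite /bichromatic_deg -(cards1 v); apply: eq_card => x.
by rewrite !inE; apply/andP/eqP => [[]|->//]; apply: uniq.
Qed.

(** * Effect of single-edge deviations on the cost *)

Lemma add_mono_improves e u v : alpha < 1 -> graph_connected e ->
  u != v -> ~~ e u v -> ty v = ty u ->
  ~ (cost ty alpha e u <= cost ty alpha (add_edge e u v) u)%E.
Proof.
move=> a1 conn uv neuv tyE; apply: (@cost_lt 1 2 _ _ _ v conn).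
- by move=> x _; exact/dist_sub/sub_add_edge.
- by apply: dist_le1; rewrite add_edge_end eqxx orbT.
- exact: dist_ge2.
- by rewrite link_cost_add_mono //; lra.
Qed.

Lemma add_bi_improves e u v : alpha < 1 -> graph_connected e -> symmetric e ->
  ty v != ty u ->
  (forall x, e u x -> ty x = ty u) -> (forall x, e v x -> ty x = ty v) ->
  ~ (cost ty alpha e u <= cost ty alpha (add_edge e u v) u)%E.
Proof.
move=> a1 conn sym tv nbru nbrv.
have neuv : ~~ e u v by apply: contra tv => /nbru ->.
have uv : u != v by apply: contra tv => /eqP->.
apply: (@cost_lt 1 3 _ _ _ v conn).
- by move=> x _; exact/dist_sub/sub_add_edge.
- by apply: dist_le1; rewrite add_edge_end eqxx orbT.
(* A common neighbour would have the types of both [u] and [v]. *)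
- apply: dist_ge3 => // x /nbru txu; rewrite sym => /nbrv txv.
  by rewrite -txv txu eqxx in tv.
- by rewrite link_cost_add_bi // bichromatic_deg0 //; lra.
Qed.

Lemma stable_intra e : alpha < 1 -> pairwise_stable ty alpha e ->
  symmetric e -> fully_intra_connected ty e.
Proof.
move=> a1 [conn _ noadd] sym u v uv tuv; apply: contraT => neuv.
have [|] := noadd u v uv neuv; last rewrite add_edgeC.
- by case/(add_mono_improves a1 conn uv neuv).
- by case/(add_mono_improves a1 conn); rewrite 1?eq_sym // sym.
Qed.

Lemma del_mono_worsens e u v : alpha < 1 -> u != v -> e u v -> ty v = ty u ->
  (cost ty alpha e u <= cost ty alpha (del_edge e u v) u)%E.
Proof.
move=> a1 uv euv tyE; apply: (@cost_le 1 2 _ _ _ v).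
- by move=> x _; exact/dist_sub/sub_del_edge.
- exact: dist_le1.
- by apply: dist_ge2; rewrite // del_edge_end eqxx andbF.
- by rewrite (link_cost_del_mono euv) //; lra.
Qed.

(** Without their matching edge [u] and [v] have no common neighbour, so the distance grows by at
    least 2, against a saving of [2 * alpha < 2]. *)
Lemma del_bi_worsens e u v : alpha < 1 -> simple_graph e ->
  (forall u v w, e u v -> ty v != ty u -> e u w -> ty w != ty u -> v = w) ->
  e u v -> ty v != ty u ->
  (cost ty alpha e u <= cost ty alpha (del_edge e u v) u)%E.
Proof.
move=> a1 [sym irr] uniq euv tv.
have uv : u != v by apply: contra tv => /eqP->.
apply: (@cost_le 1 3 _ _ _ v).
- by move=> x _; exact/dist_sub/sub_del_edge.
- exact: dist_le1.
- apply: dist_ge3; rewrite // ?del_edge_end ?eqxx ?andbF // => x.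
  rewrite del_edge_end => /andP[eux xv] /sub_del_edge exv.
  (* A common neighbour [x] would be a second partner of [v] if it has the type of [u], and a second
     partner of [u] otherwise. *)
  have [txu|txu] := eqVneq (ty x) (ty u).
    have xu : x = u by apply: (uniq v); rewrite 1?sym // ?txu eq_sym.
    by rewrite xu irr in eux.
  by rewrite (uniq u x v) ?eqxx in xv.
- rewrite (link_cost_del_bi euv tv) (@bichromatic_deg1 _ _ v) //.
    by rewrite invr1; lra.
  by move=> x eux tx; apply: uniq tv.
Qed.

(** The left factor [1 + 1/k] is smallest at [k = n], where the claim is exactly the lower bound on
    [alpha]. *)
Lemma harmonic_gap (k n : nat) : (0 < k <= n)%N ->
  n%:R / (n%:R + 1) < alpha -> alpha < 1 -> 1 < alpha * (1 + k%:R^-1).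
Proof.
move=> /andP[k0 kn]; rewrite ltr_pdivrMr ?natr1 // -natr1 => an a1.
have k0R : 0 < k%:R :> R by rewrite ltr0n.
have knR : k%:R <= n%:R :> R by rewrite ler_nat.
rewrite -(ltr_pM2r k0R) mul1r -mulrA mulrDl mul1r mulVf ?gt_eqF //.
(* [alpha (k + 1) = alpha (n + 1) - alpha (n - k) > n - (n - k) = k]. *)
nra.
Qed.

End Cost.

(** * Consequences of having only two types *)

Section TwoTypes.
Variables (R : realType) (T : finType) (ty : T -> bool) (alpha : R) (nR : nat).
(** Bounding both classes by the same [nR] lets the deviation arguments treat either colour
    alike. *)
Hypothesis small_classes : forall c, (#|agents_of_type ty c| <= nR)%N.
Hypotheses (alpha_gt : nR%:R / (nR%:R + 1) < alpha) (alpha_lt1 : alpha < 1).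
Variable e : rel T.
Hypotheses (He : simple_graph e).
Implicit Types u v w x : T.

Let sym : symmetric e := He.1.

Lemma neq_type_eq u v w : ty v != ty u -> ty w != ty u -> ty v = ty w.
Proof. by case: (ty u) (ty v) (ty w) => [] [] []. Qed.

Lemma stable_unique_bichromatic : pairwise_stable ty alpha e ->
  forall u v w, e u v -> ty v != ty u -> e u w -> ty w != ty u -> v = w.
Proof.
move=> stable u v w euv tv euw tw; apply/eqP; apply: contraT => vw.
have intra := stable_intra alpha_lt1 stable sym.
have [conn nodel _] := stable.
have other x : ty x != ty u -> x != u by apply: contra => /eqP->.
have via_w x : ty x != ty u -> w != x -> del_edge e u v w x.
  move=> tx wx; apply: del_edge_off; rewrite ?other //.
  by apply: intra => //; apply: neq_type_eq tw tx.
have duw : del_edge e u v u w by rewrite del_edge_end euw eq_sym.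
suff: ~ (cost ty alpha e u <= cost ty alpha (del_edge e u v) u)%E.
  by case; apply: nodel.
(* After the deletion [w] still links [u] to the whole opposite class, so only the distance to [v]
   changes, from 1 to 2. *)
apply: (@cost_lt _ _ _ _ _ 2 1 _ _ _ v conn).
- move=> x xv; apply: dist_le_of_diam2 => [eux|xu];
    rewrite del_edge_end xv andbT //.
  move=> neux; exists w => //; apply: via_w.
    by apply: contra neux => /eqP txu; apply: intra; rewrite // eq_sym.
  by apply: contraNneq neux => <-.
- by apply: dist_le2 duw _; apply: via_w; rewrite // eq_sym.
- by apply: dist_ge1; rewrite eq_sym other.
- have := @harmonic_gap _ _ (bichromatic_deg ty e u) _ _ alpha_gt alpha_lt1.
  rewrite (link_cost_del_bi _ euv tv) => gap.
  suff /gap : (0 < bichromatic_deg ty e u <= nR)%N by lra.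
  apply/andP; split; first by apply/card_gt0P; exists v; rewrite inE euv.
  (* Bichromatic neighbours of [u] all lie in the opposite class. *)
  apply: leq_trans (small_classes (~~ ty u)); apply/subset_leq_card/subsetP.
  by move=> x; rewrite !inE => /andP[_]; case: (ty x) (ty u) => [] [].
Qed.

Lemma add_bi_worsens u v w : fully_intra_connected ty e ->
  (forall u v w, e u v -> ty v != ty u -> e u w -> ty w != ty u -> v = w) ->
  e u w -> ty w != ty u -> ~~ e u v -> ty v != ty u ->
  (cost ty alpha e u <= cost ty alpha (add_edge e u v) u)%E.
Proof.
move=> intra uniq euw tw neuv tv.
have wv : w != v by apply: contraNneq neuv => <-.
apply: (@cost_le _ _ _ _ _ 2 1 _ _ _ v).
- move=> x xv; apply: dist_le_of_diam2.
    by rewrite add_edge_end (negbTE xv) orbF.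
  move=> xu neux; exists w => //; apply: (intra).
    by apply: contraNneq neux => <-.
  apply: neq_type_eq tw _; apply: contra neux => /eqP txu.
  by apply: (intra); rewrite // eq_sym.
- by apply: dist_le2 euw _; apply: intra => //; apply: neq_type_eq tw tv.
- by apply: dist_ge1; apply: contra tv => /eqP->.
- rewrite link_cost_add_bi // (@bichromatic_deg1 _ _ _ _ _ w) //; last first.
    by move=> x eux tx; apply: uniq tw.
  (* The new edge is the second bichromatic one at [u], hence [k = 2]; the distinct agents [v] and
     [w] share a class, hence [2 <= nR]. *)
  suff n2 : (0 < 2 <= nR)%N by have := harmonic_gap n2 alpha_gt alpha_lt1; lra.
  apply: leq_trans (small_classes (ty v)).
  rewrite (cardsD1 w) inE (neq_type_eq tw tv) eqxx ltnS.
  by apply/card_gt0P; exists v; rewrite !inE eqxx andbT eq_sym.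
Qed.

(* Were every agent of type [~~ c] matched, the matching would inject that
   class into the class [c] minus [u]. *)
Lemma exists_unmatched c u :
  (#|agents_of_type ty c| <= #|agents_of_type ty (~~ c)|)%N ->
  (forall u v w, e u v -> ty v != ty u -> e u w -> ty w != ty u -> v = w) ->
  ty u = c -> (forall x, e u x -> ty x = ty u) ->
  exists2 v, ty v != ty u & forall x, e v x -> ty x = ty v.
Proof.
move=> le_c uniq tu nbru.
have [/existsP[v /andP[tv /forallP nbrv]]|] :=
    boolP [exists v, (ty v != ty u) && [forall x, e v x ==> (ty x == ty v)]].
  by exists v => // x evx; apply/eqP; move: (nbrv x); rewrite evx.
rewrite negb_exists => /forallP matched.
(* [f] sends an agent to its partner; the default is never taken on the class opposite to [u]. *)
pose f v := odflt v [pick x | e v x & ty x != ty v].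
have fP v : ty v != ty u -> e v (f v) /\ ty (f v) != ty v.
  move=> tv; rewrite /f; case: pickP => [x /andP[] //|none].
  case/negP: (matched v); rewrite tv /=; apply/forallP => x.
  apply/implyP => evx.
  by have := none x; rewrite evx /= => /negbFE.
have class v : (v \in agents_of_type ty (~~ c)) = (ty v != ty u).
  by rewrite inE -tu; case: (ty v) (ty u) => [] [].
have f_inj : {in agents_of_type ty (~~ c) &, injective f}.
  move=> v w; rewrite !class => /fP[ev tv] /fP[ew tw] fE.
  by apply: (uniq (f v)); rewrite 1?sym // 1?eq_sym // fE.
(* The image misses [u], since all neighbours of [u] have its own type. *)
have : (#|f @: agents_of_type ty (~~ c)| <= #|agents_of_type ty c :\ u|)%N.
  apply/subset_leq_card/subsetP => _ /imsetP[v + ->]; rewrite class => tv.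
  have [evf tvf] := fP v tv; rewrite !inE -tu; apply/andP; split.
    by apply: contra tv => /eqP fu; apply/eqP/nbru; rewrite sym -fu.
  by apply/eqP/(neq_type_eq tvf); rewrite eq_sym.
rewrite card_in_imset // => le_img.
by have := leq_trans le_c le_img; rewrite (cardsD1 u) inE tu eqxx ltnn.
Qed.

(** Both classes are cliques, and the matching edge of a single blue agent [b] joins them, so every
    agent reaches [b]. *)
Lemma matching_connected : fully_intra_connected ty e ->
  (forall u, ty u -> exists2 v, e u v & ty v != ty u) ->
  (exists u, ty u) -> graph_connected e.
Proof.
move=> intra cov [b tb].
have csym : connect_sym e := sym_connect_sym sym.
have mono u v : ty u = ty v -> connect e u v.
  by have [->|uv /(intra _ _ uv)/connect1] := eqVneq u v.
have [r ebr tr] := cov b tb.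
have to_b u : connect e u b.
  have [tu|tu] := eqVneq (ty u) (ty b); first exact: mono.
  apply: (@connect_trans _ _ r); first exact/mono/(neq_type_eq tu tr).
  by rewrite csym connect1.
by move=> u v; apply: connect_trans (to_b u) _; rewrite csym.
Qed.

End TwoTypes.

Theorem theorem5p4 (R : realType) (T : finType) (ty : T -> bool) (alpha : R)
    (VB VR : {set T}) (nB nR : nat)
    (defVB : VB = agents_of_type ty blue)
    (defVR : VR = agents_of_type ty red)
    (defnB : nB = #|VB|) (defnR : nR = #|VR|)
    (VB_nonempty : VB != set0) (VR_nonempty : VR != set0)
    (le_nB_nR : (nB <= nR)%N)
    (alpha_gt0 : 0 < alpha)
    (alpha_gt : nR%:R / (nR%:R + 1) < alpha) (alpha_lt1 : alpha < 1)
    (e : rel T) (He : simple_graph e) :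
  pairwise_stable ty alpha e <->
  [/\ fully_intra_connected ty e,
      is_matching (bichromatic_edges ty e)
    & matching_covers (bichromatic_edges ty e) VB].
Proof.
have [sym irr] := He.
have small c : (#|agents_of_type ty c| <= nR)%N.
  by case: c; rewrite -?defVB -?defVR -?defnB -?defnR.
split=> [stable|].
  have uniq := stable_unique_bichromatic small alpha_gt alpha_lt1 He stable.
  split; [exact: stable_intra stable sym|exact/matchingP|].
  apply/matching_coversP => // u; rewrite defVB inE => /eqP tu.
  have [/existsP[v /andP[euv tv]]|] :=
      boolP [exists v, e u v && (ty v != ty u)].
    by exists v.
  rewrite negb_exists => /forallP none.
  have nbru x : e u x -> ty x = ty u.
    by move=> eux; apply/eqP; have := none x; rewrite eux /= negbK.
  have le_classes :
      (#|agents_of_type ty true| <= #|agents_of_type ty (~~ true)|)%N.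
    by rewrite /= -defVB -defVR -defnB -defnR.
  have [v tv nbrv] := exists_unmatched He le_classes uniq tu nbru.
  have [conn _ noadd] := stable.
  have uv : u != v by apply: contra tv => /eqP->.
  have neuv : ~~ e u v by apply: contra tv => /nbru->.
  (* Both endpoints gain from the edge, so each alternative of the addition clause fails. *)
  have [|] := noadd u v uv neuv.
    by case/(add_bi_improves alpha_lt1 conn sym tv nbru nbrv).
  by rewrite add_edgeC; case/add_bi_improves; rewrite // eq_sym.
move=> [intra /(matchingP _ sym) uniq /(matching_coversP _ _ sym) cov].
have blue_nbr u : ty u -> exists2 v, e u v & ty v != ty u.
  by move=> tu; apply: cov; rewrite defVB inE tu.
split.
- apply: (matching_connected He intra blue_nbr).
  by case/set0Pn: VB_nonempty => u; rewrite defVB inE => /eqP tu; exists u.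
- move=> u v euv; have [tyE|tv] := eqVneq (ty v) (ty u).
    by apply: del_mono_worsens => //; apply: contraTneq euv => ->; rewrite irr.
  exact: del_bi_worsens.
- move=> u v uv neuv.
  (* A missing edge is bichromatic because the classes are cliques. It suffices that its blue
     endpoint, already matched, does not gain. *)
  have tv : ty v != ty u by apply: contra neuv => /eqP tvu; apply: intra.
  have [tu|ntu] := boolP (ty u).
    have [w euw tw] := blue_nbr u tu.
    by left; apply: (add_bi_worsens small alpha_gt alpha_lt1 intra uniq euw).
  have tbv : ty v by move: tv ntu; case: (ty v) (ty u) => [] [].
  have [w evw tw] := blue_nbr v tbv.
  right; rewrite add_edgeC.
  by apply: (add_bi_worsens small alpha_gt alpha_lt1 intra uniq evw);
    rewrite // 1?sym // eq_sym.
Qed.
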